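(* Let $I$ be a proper ideal of a numerical semigroup $S$ and let $\mu(I)$ be the smallest element of $I$. If $p(X_1,\dots,X_n)=\sum_{i=1}^n a_iX_i+a_0$ is a linear surjective endopattern of $I$, then $a_0=-\left(\sum_{i=1}^n a_i-1\right)\mu(I)$. Moreover, if $p(X_1,\dots,X_n)=\sum_{i=1}^n a_iX_i+a_0$ is a premonic linear endopattern of $I$ such that $a_0=-\left(\sum_{i=1}^n a_i-1\right)\mu(I)$, then $p$ is surjective, i.e. $p(I)=I$.
   Context: $\mathbb{Z}_+$ denotes the set of non-negative integers. A numerical semigroup is a subset of $\mathbb{Z}_+$ that contains $0$, is closed under addition and has finite complement in $\mathbb{Z}_+$. An ideal of a numerical semigroup $S$ is a nonempty subset $I\subseteq S$ with $I+S\subseteq I$; it is proper if $I\ne S$. A linear endopattern of $I$ is a polynomial $p(X_1,\dots,X_n)=\sum_{i=1}^n a_iX_i+a_0$ with integer coefficients such that $p(s_1,\dots,s_n)\in I$ for every non-increasing sequence $s_1\ge\cdots\ge s_n$ of elements of $I$. Its image is $p(I)=\{p(s_1,\dots,s_n): s_1\ge\cdots\ge s_n,\ s_i\in I\}$, and it is a surjective endopattern of $I$ if $p(I)=I$. It is premonic if $\sum_{i=1}^{n'}a_i=1$ for some $1\le n'\leq n$. *)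

(* Defs.v *)
From mathcomp Require Import all_boot all_order all_algebra.
From mathcomp Require Import boolp classical_sets cardinality.

Set Implicit Arguments.
Unset Strict Implicit.
Unset Printing Implicit Defensive.

Import Order.TTheory GRing.Theory Num.Theory.
Local Open Scope classical_set_scope.
Local Open Scope ring_scope.

Definition numerical_semigroup (S : set nat) : Prop :=
  [/\ S 0%N,
      forall x y : nat, S x -> S y -> S (x + y)%N
    & finite_set (~` S)].

Definition semigroup_ideal (S I : set nat) : Prop :=
  [/\ I !=set0,
      I `<=` S
    & forall x s : nat, I x -> S s -> I (x + s)%N].

Definition proper_semigroup_ideal (S I : set nat) : Prop :=
  semigroup_ideal S I /\ I <> S.

(* The smallest element of [I]; the default value 0 is only reached when [I]
   is empty. *)
Definition mu (I : set nat) : nat :=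
  xget 0%N [set m | I m /\ forall x : nat, I x -> (m <= x)%N].

Lemma muP (I : set nat) :
  I !=set0 -> I (mu I) /\ forall x : nat, I x -> (mu I <= x)%N.
Proof.
move=> [x Ix]; have exI : exists m, `[< I m >] by exists x; apply/asboolP.
case: (ex_minnP exI) => m /asboolP Im minm.
rewrite /mu; case: xgetP => [y _ //| /(_ m)[]].
by split=> // y Iy; apply/minm/asboolP.
Qed.

(* The value at [s] of the linear polynomial with constant term [a0] in which
   [a i] is the coefficient of the (i+1)-st variable; indices start at 0. *)
Definition linpoly_eval (n : nat) (a : 'I_n -> int) (a0 : int)
    (s : 'I_n -> nat) : int :=
  \sum_(i < n) a i * (s i)%:Z + a0.

Definition nonincreasing_in (n : nat) (I : set nat) : set ('I_n -> nat) :=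
  [set s | (forall i, I (s i)) /\ forall i j : 'I_n, (i <= j)%N -> (s j <= s i)%N].

Definition pattern_image (n : nat) (a : 'I_n -> int) (a0 : int)
    (I : set nat) : set int :=
  linpoly_eval a a0 @` nonincreasing_in I.

(* [Posz @` I] is [I] viewed as a set of integers, since a polynomial with
   integer coefficients takes its values in [int]. *)
Definition endopattern (n : nat) (a : 'I_n -> int) (a0 : int)
    (I : set nat) : Prop :=
  forall s, nonincreasing_in I s -> (Posz @` I) (linpoly_eval a a0 s).

Definition surjective_endopattern (n : nat) (a : 'I_n -> int) (a0 : int)
    (I : set nat) : Prop :=
  endopattern a a0 I /\ pattern_image a a0 I = Posz @` I.

Definition premonic (n : nat) (a : 'I_n -> int) : Prop :=
  exists n' : nat,
    [/\ (1 <= n')%N, (n' <= n)%N & \sum_(i < n | (i < n')%N) a i = 1].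

(* Main.v *)
Require Import Defs.
From mathcomp Require Import all_boot all_order all_algebra.
From mathcomp Require Import boolp classical_sets cardinality.
From mathcomp Require Import ring lra zify.

Set Implicit Arguments.
Unset Strict Implicit.
Unset Printing Implicit Defensive.

Import Order.TTheory GRing.Theory Num.Theory.
Local Open Scope classical_set_scope.
Local Open Scope ring_scope.

(** Write [m] for the smallest element of [I]. The condition on the constant
    term says exactly that the polynomial fixes [m], i.e. that its value at the
    constant sequence [m] is [m].

    For the first part, let the [k] first entries of a sequence be a large
    element of [I] and the others be [m]: the value must stay nonnegative, so
    every partial sum [a_1 + ... + a_k] is nonnegative ([initial_sum_ge0]).
    Slicing a nonincreasing sequence into horizontal layers, each of which is
    an initial segment of the indices, shows that the constant sequence [m]
    minimises the polynomial ([endopattern_min]). If the polynomial is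
    surjective its minimal value is [m], as required.

    For the second part, let the [n'] first entries of a sequence be [x] and the
    others be [m], where the [n'] first coefficients add up to 1. The value is
    [x] plus the value at the constant sequence [m] minus [m], that is, [x]. *)

(** If all elements of [I] were below [N], so would be those of a translate of
    [S] that lies in [I]; then [S] and its complement would both be finite. *)
Lemma semigroup_ideal_unbounded (S I : set nat) (N : nat) :
  numerical_semigroup S -> semigroup_ideal S I -> exists2 x, I x & (N <= x)%N.
Proof.
move=> [_ _ finC] [[y Iy] _ IS]; apply: contrapT => nox.
have finS : finite_set S.
  apply: (@sub_finite_set _ _ `I_N) => // s Ss.
  rewrite /= ltnNge; apply/negP => leNs; apply: nox.
  by exists (y + s)%N; [exact: IS | exact: leq_trans leNs (leq_addl _ _)].
by apply: infinite_nat; rewrite -(setUv S) finite_setU.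
Qed.

Definition initial_segment (n : nat) (P : pred 'I_n) : Prop :=
  forall i j : 'I_n, (i <= j)%N -> P j -> P i.

Definition step_seq (n : nat) (P : pred 'I_n) (x m : nat) : 'I_n -> nat :=
  fun i => if P i then x else m.

Lemma step_seq_nonincreasing (n : nat) (I : set nat) (P : pred 'I_n) x m :
  initial_segment P -> I x -> I m -> (m <= x)%N ->
  nonincreasing_in I (step_seq P x m).
Proof.
move=> initP Ix Im lemx; split=> [i|i j leij]; rewrite /step_seq.
  by case: ifP.
by case: (boolP (P j)) => [/(initP _ _ leij) -> //|_]; case: ifP.
Qed.

Lemma linpoly_eval_step (n : nat) (a : 'I_n -> int) a0 (P : pred 'I_n) x m :
  linpoly_eval a a0 (step_seq P x m) =
  (\sum_(i < n | P i) a i) * (x%:Z - m%:Z) + (\sum_(i < n) a i) * m%:Z + a0.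
Proof.
rewrite /linpoly_eval [X in X * _ + _]big_mkcond !mulr_suml -big_split /=.
congr (_ + a0).
by apply: eq_bigr => i _; rewrite /step_seq; case: (P i); ring.
Qed.

Lemma linpoly_eval_cst (n : nat) (a : 'I_n -> int) a0 m :
  linpoly_eval a a0 (fun=> m) = (\sum_(i < n) a i) * m%:Z + a0.
Proof. by rewrite /linpoly_eval mulr_suml. Qed.

(** A negative sum would make the value at [step_seq P x m] negative as soon as
    [x] is large. *)
Lemma initial_sum_ge0 (n : nat) (I : set nat) (a : 'I_n -> int) a0
    (P : pred 'I_n) :
  (forall N : nat, exists2 x, I x & (N <= x)%N) ->
  endopattern a a0 I -> initial_segment P -> 0 <= \sum_(i < n | P i) a i.
Proof.
move=> unbI endoI initP; have [m Im _] := unbI 0%N.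
set A := \sum_(i < n) a i.
(* This bound makes [x - m] exceed the absolute value of all the other terms. *)
have [x Ix lex] := unbI (m + `|(A * m%:Z + a0)%R| + 1)%N.
have lemx : (m <= x)%N by lia.
have [y _] := endoI _ (step_seq_nonincreasing initP Ix Im lemx).
rewrite linpoly_eval_step -/A => valE; rewrite leNgt; apply/negP.
by set b := \sum_(_ < _ | _) _ in valE * => blt0; nia.
Qed.

(** Layer-cake decomposition: [t i] counts the levels [v] with [v < t i], and
    for each level the indices that reach it form an initial segment. *)
Lemma sum_nonincreasing_ge0 (n : nat) (a : 'I_n -> int) (t : 'I_n -> nat) :
  (forall P : pred 'I_n, initial_segment P -> 0 <= \sum_(i < n | P i) a i) ->
  (forall i j : 'I_n, (i <= j)%N -> (t j <= t i)%N) ->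
  0 <= \sum_(i < n) a i * (t i)%:Z.
Proof.
move=> a_ge0 t_dec; pose M := \max_(i < n) t i.
have layer i : (t i)%:Z = \sum_(v < M) (v < t i)%N%:R :> int.
  have letM : (t i <= M)%N by exact: leq_bigmax.
  rewrite (eq_bigr (fun v : 'I_M => if (v < t i)%N then 1 else 0)); last first.
    by move=> v _; case: ifP.
  by rewrite -big_mkcond (big_ord_narrow letM) sumr_const card_ord natz.
under eq_bigr do rewrite layer mulr_sumr.
rewrite exchange_big sumr_ge0 //= => v _.
under eq_bigr do rewrite mulr_natr mulrb.
rewrite -big_mkcond a_ge0 // => i j leij lt_v_tj.
exact: leq_trans lt_v_tj (t_dec _ _ leij).
Qed.

Lemma endopattern_min (n : nat) (I : set nat) (a : 'I_n -> int) a0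
    (m : nat) s :
  (forall N : nat, exists2 x, I x & (N <= x)%N) ->
  (forall x, I x -> (m <= x)%N) ->
  endopattern a a0 I -> nonincreasing_in I s ->
  linpoly_eval a a0 (fun=> m) <= linpoly_eval a a0 s.
Proof.
move=> unbI minm endoI [Is s_dec]; rewrite lerD2r -subr_ge0 -sumrB.
have -> : \sum_(i < n) (a i * (s i)%:Z - a i * m%:Z)
          = \sum_(i < n) a i * (s i - m)%N%:Z.
  by apply: eq_bigr => i _; rewrite -mulrBr subzn ?minm.
apply: sum_nonincreasing_ge0 => [P|i j /s_dec]; last exact: leq_sub2r.
exact: initial_sum_ge0 unbI endoI.
Qed.

Theorem proposition20 (S I : set nat)
    (S_semigroup : numerical_semigroup S)
    (I_proper : proper_semigroup_ideal S I) :
  (forall (n : nat) (a : 'I_n -> int) (a0 : int),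
      surjective_endopattern a a0 I ->
      a0 = - ((\sum_(i < n) a i - 1) * (mu I)%:Z)) /\
  (forall (n : nat) (a : 'I_n -> int) (a0 : int),
      premonic a -> endopattern a a0 I ->
      a0 = - ((\sum_(i < n) a i - 1) * (mu I)%:Z) ->
      surjective_endopattern a a0 I).
Proof.
have [idealI _] := I_proper; have [I_neq0 _ _] := idealI.
have unbI N := semigroup_ideal_unbounded N S_semigroup idealI.
have [Imu minmu] := muP I_neq0; split=> n a a0.
  case=> endoI imE.
  (* [mu I] is a value, so the least value is at most [mu I]; being an element
     of [I], the least value is also at least [mu I]. *)
  have [s s_in sE] : pattern_image a a0 I (mu I) by rewrite imE; exists (mu I).
  have cst_in : nonincreasing_in I (fun _ : 'I_n => mu I) by split.
  have [y Iy yE] := endoI _ cst_in.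
  have := endopattern_min unbI minmu endoI s_in.
  have := minmu _ Iy; rewrite sE -yE lez_nat => le_mu_y le_y_mu.
  have y_mu : y = mu I by apply/eqP; rewrite eqn_leq le_y_mu.
  by move: yE; rewrite y_mu linpoly_eval_cst => muE; lra.
case=> n' [_ _ sum1] endoI a0E; split=> //; apply/seteqP; split.
  by move=> _ [s s_in <-]; exact: endoI.
move=> _ [x Ix <-]; exists (step_seq (fun i : 'I_n => i < n')%N x (mu I)).
  apply: step_seq_nonincreasing => //; last exact: minmu.
  by move=> i j; exact: leq_ltn_trans.
by rewrite linpoly_eval_step sum1 a0E; ring.
Qed.
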